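(* Let $U$ be a unitary operator in a Hilbert space $\mathcal H$ and let $A$ be a self-adjoint operator in $\mathcal H$ with $U\in C^1(A)$. Assume that the limit $$D=\lim_{N\to\infty}\frac1N\big[A,U^N\big]U^{-N}$$ exists in the norm topology of $\mathscr B(\mathcal H)$ and satisfies $D\in C^1(A)$. Then, for each $\varepsilon>0$ there exists $N_\varepsilon\in\mathbb N^*$ such that $$U^{-1}\big[A_{D,N},U\big]\ge2D^2-\varepsilon\quad\hbox{for all }N\ge N_\varepsilon.$$ In particular, if there exist an open set $\Theta\subset\mathbb S^1$ and $c_\Theta>0$ such that $D^2E^U(\Theta)\ge c_\Theta E^U(\Theta)$, then there exist $N\in\mathbb N^*$ and $a>0$ such that $$E^U(\Theta)U^{-1}\big[A_{D,N},U\big]E^U(\Theta)\ge aE^U(\Theta).$$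
   Context: $\mathscr B(\mathcal H)$ is the set of bounded linear operators on the Hilbert space $\mathcal H$, whose scalar product $\langle\cdot,\cdot\rangle$ is antilinear in the first argument; $\mathbb S^1=\{z\in\mathbb C: |z|=1\}$; $E^U$ is the spectral measure of $U$; $\mathbb N^*=\{1,2,\dots\}$. Let $A$ be self-adjoint in $\mathcal H$ with domain $\mathcal D(A)$, and $S\in\mathscr B(\mathcal H)$. One writes $S\in C^1(A)$ if $\mathbb R\ni t\mapsto e^{-itA}Se^{itA}\in\mathscr B(\mathcal H)$ is strongly of class $C^1$, equivalently if the quadratic form $\mathcal D(A)\ni\varphi\mapsto\langle\varphi,SA\varphi\rangle-\langle A\varphi,S\varphi\rangle$ is continuous for the topology induced by $\mathcal H$ on $\mathcal D(A)$; $[S,A]$ denotes the bounded operator associated with its continuous extension, and $[A,S]:=-[S,A]$. If $U\in C^1(A)$ is unitary, then $U^N\in C^1(A)$ for all $N\in\mathbb Z$. $A_D$ denotes the self-adjoint operator which is the closure of the essentially self-adjoint operator $\varphi\mapsto(AD+DA)\varphi$, $\varphi\in\mathcal D(A)$ ($D$ is bounded, self-adjoint and in $C^1(A)$). For $N\in\mathbb N^*$, $$A_{D,N}\varphi:=\frac1N\sum_{n=0}^{N-1}U^nA_DU^{-n}\varphi,\quad\varphi\in\mathcal D(A_{D,N}):=\mathcal D(A_D),$$ which is a self-adjoint operator, and one has $U\in C^1(A_{D,N})$, so that $[A_{D,N},U]$ is a well-defined bounded operator. *)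

(* Defs.v *)
(* A complex Hilbert space is a complete normed module H
   over R[i] with a positive definite hermitian form ip inducing its norm.
   The form types of MathComp are linear in the FIRST argument, so the scalar
   product antilinear in the first argument is <x, y> := ip y x. *)
From HB Require Import structures.
From mathcomp Require Import all_boot all_order all_algebra.
From mathcomp Require Import sesquilinear complex.
From mathcomp Require Import all_classical all_reals all_analysis.

Set Implicit Arguments.
Unset Strict Implicit.
Unset Printing Implicit Defensive.

Import Order.TTheory GRing.Theory Num.Theory.
Import numFieldNormedType.Exports.

Local Open Scope classical_set_scope.
Local Open Scope ring_scope.

Section hilbert.
Context {R : realType} {H : completeNormedModType R[i]}.
Implicit Types (ip : {dot H for (@Num.conj R[i])}) (S T U V D : H -> H).

Definition hilbert_norm ip := forall x : H, ip x x = `|x| ^+ 2.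

Definition inner ip (x y : H) : R[i] := ip y x.

Definition bounded_op T :=
  linear T /\ exists M : R[i], forall x, `|T x| <= M * `|x|.

(* The order of R[i] is 0 <= z iff z is a nonnegative real number. *)
Definition op_le ip S T := forall x, 0 <= inner ip x (T x - S x).

Definition op_norm_cvg (T : nat -> H -> H) S :=
  forall e : R, 0 < e ->
    \forall n \near \oo, forall x, `|T n x - S x| <= e%:C%C * `|x|.

Definition unitary ip U :=
  [/\ linear U, forall x y, inner ip (U x) (U y) = inner ip x y
    & forall y, exists x, U x = y].

Definition inv_op U : H -> H := fun y => xget 0 [set x | U x = y].

(* Possibly unbounded operators: app is only meaningful on dom. *)
Record partial_op := PartialOp { dom : set H; app :> H -> H }.

Implicit Type A : partial_op.

Definition linear_op A :=
  dom A 0 /\ forall (a : R[i]) x y, dom A x -> dom A y ->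
    dom A (a *: x + y) /\ A (a *: x + y) = a *: A x + A y.

Definition selfadjoint ip A :=
  [/\ linear_op A, dense (dom A)
    & forall x y, (dom A x /\ A x = y) <->
        (forall z, dom A z -> inner ip x (A z) = inner ip y z)].

Definition graph A : set (H * H) := [set p | dom A p.1 /\ p.2 = A p.1].

(* The operator whose graph is the closure of the graph of A, for A closable. *)
Definition closure_op A : partial_op :=
  PartialOp [set x | exists y, closure (graph A) (x, y)]
            (fun x => xget 0 [set y | closure (graph A) (x, y)]).

(* W t = e^{itA}: the strongly continuous unitary group W whose generator is A
   in the sense of Stone's theorem, which gives its existence and uniqueness
   for self-adjoint A. *)
Definition is_exp_group ip A (W : R -> H -> H) :=
  [/\ forall t, unitary ip (W t),
      (forall x, W 0 x = x) /\ (forall s t x, W (s + t) x = W s (W t x)),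
      forall x, continuous (W^~ x)
    & forall x y, (dom A x /\ A x = y) <->
        (h^-1)%:C%C *: (W h x - x) @[h --> 0^'] --> 'i *: y].

Definition strongly_C1 (F : R -> H -> H) := forall x, exists2 g : R -> H,
  forall t, (h^-1)%:C%C *: (F (t + h) x - F t x) @[h --> 0^'] --> g t
  & continuous g.

Definition C1 ip S A := bounded_op S /\
  exists2 W, is_exp_group ip A W & strongly_C1 (fun t => W (- t) \o S \o W t).

(* [S, A]: the bounded operator associated with the continuous extension of the
   quadratic form x |-> <x, S A x> - <A x, S x> on dom A; it is unique when dom A
   is dense, and the default 0 is unused when S is of class C^1(A). *)
Definition comm ip S A : H -> H := xget (fun=> 0) [set B |
  bounded_op B /\ forall x, dom A x ->
    inner ip x (B x) = inner ip x (S (A x)) - inner ip (A x) (S x)].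

(* [A, S] *)
Definition rcomm ip A S : H -> H := fun x => - comm ip S A x.

Definition anticomm_op A D : partial_op :=
  closure_op (PartialOp (dom A) (fun x => A (D x) + D (A x))).

Definition averaged_op U A (N : nat) : partial_op :=
  PartialOp (dom A) (fun x =>
    N%:R^-1 *: \sum_(0 <= n < N) iter n U (A (iter n (inv_op U) x))).

Definition unit_circle : set R[i]^o := [set z | `|z| = 1].

Definition borelC := g_sigma_algebraType (@open R[i]^o).

Definition orth_projection ip T :=
  [/\ bounded_op T, forall x, T (T x) = T x
    & forall x y, inner ip (T x) y = inner ip x (T y)].

(* The resolution of the identity E of U, on the Borel subsets of C and carried
   by the unit circle.  The complex equality <x, U x> = \int z <x, E(dz) x> is
   split into real and imaginary parts. *)
Definition spectral_measure ip U (E : set borelC -> H -> H) :=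
  [/\ forall Z, measurable Z -> orth_projection ip (E Z),
      forall x, E unit_circle x = x,
      forall Y Z x, measurable Y -> measurable Z ->
        E (Y `&` Z) x = E Y (E Z x),
      forall (Z : nat -> set borelC) x, (forall n, measurable (Z n)) ->
        trivIset setT Z ->
        \sum_(0 <= k < n) E (Z k) x @[n --> \oo] --> E (\bigcup_n Z n) x
    & forall x, exists2 mu : {measure set borelC -> \bar R},
        forall Z, measurable Z -> mu Z = (complex.Re (inner ip x (E Z x)))%:E &
        inner ip x (U x) =
          (\int[mu]_(z in unit_circle) complex.Re z +i*
           \int[mu]_(z in unit_circle) complex.Im z)%C].

End hilbert.

(* Main.v *)
Require Import Defs.
From HB Require Import structures.
From mathcomp Require Import all_boot all_order all_algebra.
From mathcomp Require Import sesquilinear complex.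
From mathcomp Require Import all_classical all_reals all_analysis.
From mathcomp Require Import ring.

Set Implicit Arguments.
Unset Strict Implicit.
Unset Printing Implicit Defensive.

Import Order.TTheory GRing.Theory Num.Theory.
Import numFieldNormedType.Exports.

Local Open Scope classical_set_scope.
Local Open Scope ring_scope.

(** Put [V = U^(-1)] and [K_N = [A, U^N] V^N], so that [K_N = A - U^N A V^N] on the
    domain of [A], and [D] is the norm limit of [K_N / N].

    Each [K_N] is symmetric, hence so is [D]. Moreover [U K_N V - K_N] is equal to
    [U^N K_1 V^N - K_1], which is bounded uniformly in [N], so dividing by [N]
    shows that [D] commutes with [U] ([limit_sym], [limit_comm]). Let [G] be the
    closure of [A D + D A]. Because [D] commutes with [U], conjugation acts only on
    the factors [A], and [G - U^N G V^N = K_N D + D K_N] on the domain of [G].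

    The commutator of [U] with the average [G_N] of the operators [U^n G V^n],
    [n < N], telescopes ([has_comm_averaged]):
    [[G_N, U] = (G_N - U G_N V) U = (1/N) (K_N D + D K_N) U].
    Hence [V [G_N, U]] is unitarily equivalent, through [U], to
    [(K_N / N) D + D (K_N / N)], which converges in norm to [2 D^2]; since all
    these operators are symmetric, norm convergence gives the lower bound
    ([anticommutator_lower_bound]). The localized estimate follows on applying this
    bound with [e = c] to vectors in the range of [E Theta].

    What must be justified is the algebra with unbounded operators. The
    regularity hypotheses are used in the form [has_comm]: [U], [V] and [D]
    preserve the domain of [A] and have bounded commutators with it. This is read
    off the derivative at time 0 of the orbits under the unitary group of [A]
    ([C1_has_comm], [C1_has_comm_inv]); the derivative is bounded by the uniform
    boundedness principle ([uniform_boundedness]). Commutator relations pass from [A D + D A] to its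
    closure as an invariance of graphs ([has_comm_closure_op]), and they determine
    the commutators defined by quadratic forms ([comm_has_comm]). *)

(** * Bounded operators *)

Section bounded_operators.
Context {R : realType} {H : completeNormedModType R[i]}.
Implicit Types (S T : H -> H) (x y : H).

Definition linear_pack T (lT : linear T) : {linear H -> H} :=
  HB.pack T (GRing.isLinear.Build _ _ _ _ T lT).

Lemma linear_op0 T : linear T -> T 0 = 0.
Proof. by move=> lT; exact: (linear0 (linear_pack lT)). Qed.

Lemma linear_opN T : linear T -> {morph T : x / - x}.
Proof. by move=> lT; exact: (linearN (linear_pack lT)). Qed.

Lemma linear_opD T : linear T -> {morph T : x y / x + y}.
Proof. by move=> lT; exact: (linearD (linear_pack lT)). Qed.

Lemma linear_opB T : linear T -> {morph T : x y / x - y}.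
Proof. by move=> lT; exact: (linearB (linear_pack lT)). Qed.

Lemma linear_opZ T : linear T -> scalable T.
Proof. by move=> lT; exact: (linearZZ (linear_pack lT)). Qed.

Lemma linear_comp S T : linear S -> linear T -> linear (S \o T).
Proof. by move=> lS lT a x y /=; rewrite lT lS. Qed.

Lemma linear_add S T : linear S -> linear T -> linear (fun x => S x + T x).
Proof. by move=> lS lT a x y; rewrite lS lT scalerDr addrACA. Qed.

Lemma linear_scale (c : R[i]) T : linear T -> linear (fun x => c *: T x).
Proof.
by move=> lT a x y; rewrite lT scalerDr !scalerA mulrC.
Qed.

(** The constant in [bounded_op] is an arbitrary complex number; since it
    multiplies norms, its modulus serves as well, and 1 is added for positivity. *)
Lemma bounded_opP T : bounded_op T ->
  exists2 M : R, 0 < M & forall x, `|T x| <= M%:C%C * `|x|.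
Proof.
move=> [lT [M TM]]; have /complex_realP[m Mm] := normr_real M.
have m0 : 0 <= m by rewrite -ler0c -Mm.
exists (m + 1) => [|x]; first by rewrite ltr_wpDl.
rewrite rmorphD/= -Mm rmorph1 mulrDl mul1r.
rewrite (@le_trans _ _ (`|M| * `|x|)) ?lerDl//.
have h : 0 <= M * `|x| by exact: le_trans (TM x).
by rewrite -[`|x|]normr_id -normrM (ger0_norm h).
Qed.

Lemma bounded_op_linear T : bounded_op T -> linear T.
Proof. by case. Qed.

Lemma bounded_op_comp S T : bounded_op S -> bounded_op T -> bounded_op (S \o T).
Proof.
move=> bS bT; split; first by apply: linear_comp; apply: bounded_op_linear.
have [M M0 SM] := bounded_opP bS; have [N N0 TN] := bounded_opP bT.
exists (M%:C * N%:C)%C => x /=; apply: (le_trans (SM _)).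
by rewrite -mulrA ler_wpM2l// ler0c ltW.
Qed.

Lemma bounded_op_add S T : bounded_op S -> bounded_op T ->
  bounded_op (fun x => S x + T x).
Proof.
move=> bS bT; split; first by apply: linear_add; apply: bounded_op_linear.
have [M M0 SM] := bounded_opP bS; have [N N0 TN] := bounded_opP bT.
exists (M%:C + N%:C)%C => x /=; apply: (le_trans (ler_normD _ _)).
by rewrite mulrDl lerD.
Qed.

Lemma bounded_op_scale (c : R[i]) T : bounded_op T ->
  bounded_op (fun x => c *: T x).
Proof.
move=> bT; split; first exact/linear_scale/bounded_op_linear.
have [N N0 TN] := bounded_opP bT.
by exists (`|c| * N%:C%C) => x; rewrite normrZ -mulrA ler_wpM2l.
Qed.

Lemma bounded_op_opp T : bounded_op T -> bounded_op (fun x => - T x).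
Proof.
move=> /(bounded_op_scale (-1)).
by under [X in bounded_op X -> _]funext do rewrite scaleN1r.
Qed.

Lemma bounded_op_iter n T : bounded_op T -> bounded_op (iter n T).
Proof.
move=> bT; elim: n => [|n IH]; last exact: (bounded_op_comp bT IH).
by split => //; exists 1 => x; rewrite mul1r.
Qed.

Lemma bounded_op_continuous T : bounded_op T -> continuous T.
Proof.
move=> bT; apply: (@linear_bounded_continuous _ _ _ (linear_pack (bounded_op_linear bT))).1.
have [M M0 TM] := bounded_opP bT.
apply/bounded_funP => r; exists (M%:C%C * r) => x xr; apply: (le_trans (TM x)).
by rewrite ler_wpM2l// ler0c ltW.
Qed.

Lemma bounded_op_cvg T (I : Type) (F : set_system I) (f : I -> H) y :
  Filter F -> bounded_op T ->
  f i @[i --> F] --> y -> T (f i) @[i --> F] --> T y.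
Proof. by move=> FF bT; apply: continuous_cvg; exact: bounded_op_continuous. Qed.

Lemma closure_sub_closed (X : topologicalType) (G C : set X) :
  closed C -> G `<=` C -> closure G `<=` C.
Proof. by move=> /closure_id CE /closureS; rewrite -CE. Qed.

(** Identities between bounded operators are checked on the dense domain of the
    unbounded one and extended to the whole space through this lemma. *)
Lemma dense_closed (A C : set H) : dense A -> closed C -> A `<=` C -> forall x, C x.
Proof.
move=> dA cC AC x; apply: contrapT => Cx.
have [] := dA (~` C) _ (closed_openC cC); first by exists x.
by move=> y [/= Cy Ay]; exact/Cy/AC.
Qed.

Lemma bounded_op_eq (A : set H) S T : dense A -> bounded_op S -> bounded_op T ->
  (forall x, A x -> S x = T x) -> forall x, S x = T x.
Proof.
move=> dA bS bT ST x; apply/eqP; rewrite -subr_eq0; apply/eqP.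
pose C := (fun x => S x - T x) @^-1` [set 0].
have cC : closed C.
  apply: preimage_closed; last exact: (accessible_closed_set1 (hausdorff_accessible (@norm_hausdorff _ _))).
  by move=> y _; apply: cvgB; exact: bounded_op_continuous.
by apply: (dense_closed dA cC _ x) => y Ay; rewrite /C /= ST// subrr.
Qed.

End bounded_operators.

(** * Uniform boundedness over the complex scalars *)

Section uniform_boundedness.
Context {R : realType} {H : completeNormedModType R[i]}.
Implicit Types (T : nat -> H -> H).

Lemma complex_nat_gt (z : R[i]) : 0 <= z -> exists n : nat, z < n%:R.
Proof.
move=> z0; have /complex_realP[m zm] := ger0_real z0.
exists (Num.truncn m).+1.
by rewrite zm -(rmorph_nat (real_complex R)) ltcR truncnS_gt.
Qed.

(** Bounded changes of the commutators with [U^n] are invisible in the limit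
    of their averages: this is how [D] is seen to commute with [U]. *)
Lemma cvg_inv_nat_bounded (w : nat -> H) (C : R[i]) y :
  (forall n, `|w n| <= C) -> n%:R^-1 *: w n @[n --> \oo] --> y -> y = 0.
Proof.
move=> wC wy; apply/eqP; rewrite -normr_le0; apply/negPn/negP => yp.
have {yp} y0 : 0 < `|y| by rewrite real_ltNge.
have C0 : 0 <= C by exact: le_trans (wC 0%N).
have [m Hm] := complex_nat_gt (divr_ge0 C0 (ltW (divr_gt0 y0 (ltr0n _ 2)))).
have [N _ h] := @cvgr_dist_lt _ _ _ _ _ _ _ wy _ (divr_gt0 y0 (ltr0n _ 2)).
pose n := (N + m.+1)%N.
have n0 : 0 < n%:R :> R[i] by rewrite ltr0n /n addnS.
have {}h := h n (leq_addr _ _).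
have hw : `|n%:R^-1 *: w n| < `|y| / 2.
  rewrite normrZ gtr0_norm ?invr_gt0// ltr_pdivrMl//.
  apply: (le_lt_trans (wC n)); rewrite -ltr_pdivrMr ?divr_gt0//.
  by apply: (lt_le_trans Hm); rewrite ler_nat /n addnS ltnW// ltnS leq_addl.
have := ler_normD (y - n%:R^-1 *: w n) (n%:R^-1 *: w n).
by rewrite subrK => /le_lt_trans /(_ (ltrD h hw)); rewrite -splitr ltxx.
Qed.

(** One step of the gliding hump. A member of the family that is large on a small
    vector [u] is large at [x + u] or at [x - u], because the difference of the
    two values is twice the value at [u]; by continuity it stays large on a
    smaller ball around that point. *)
Lemma large_value_ball T : (forall n, bounded_op (T n)) ->
  ~ (exists M : R[i], forall n x, `|T n x| <= M * `|x|) ->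
  forall (N : nat) (x : H) (r : R[i]), 0 < r ->
  exists (y : H) (s : R[i]), [/\ 0 < s, s <= r / 2, `|x - y| + s <= r &
    exists n, forall z, `|z - y| <= s -> N%:R <= `|T n z|].
Proof.
move=> bT nb N x r r0.
have r20 : 0 < r / 2 by rewrite divr_gt0.
have [n [z Hz]] : exists n z, (N.+1%:R / (r / 2)) * `|z| < `|T n z|.
  apply: contra_notP nb => nb; exists (N.+1%:R / (r / 2)) => n z.
  rewrite real_leNgt ?normr_real//; last first.
    by rewrite rpredM ?normr_real// gtr0_real// divr_gt0.
  by apply/negP => h; apply: nb; exists n, z.
have lT := bounded_op_linear (bT n).
have z0 : 0 < `|z|.
  rewrite normr_gt0; apply/negP => /eqP z0; move: Hz.
  by rewrite z0 linear_op0// normr0 mulr0 ltxx.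
pose u := (r / 2 / `|z|) *: z.
have nu : `|u| = r / 2.
  by rewrite normrZ ger0_norm ?divfK ?gt_eqF// ltW// divr_gt0.
have Tu : N.+1%:R <= `|T n u|.
  rewrite linear_opZ// normrZ (ger0_norm (ltW (divr_gt0 _ _)))//.
  rewrite mulrAC ler_pdivlMr//  -ler_pdivrMl// mulrA [_^-1 * _]mulrC.
  exact: ltW.
have [y Ty xy] : exists2 y, N.+1%:R <= `|T n y| & `|x - y| = r / 2.
  have [h|h] := boolP (N.+1%:R <= `|T n (x + u)|).
    by exists (x + u) => //; rewrite opprD addrA subrr add0r normrN.
  exists (x - u); last by rewrite opprB addrC subrK.
  have h1 : `|T n (x + u)| <= N.+1%:R.
    by rewrite ltW// real_ltNge// ?normr_real ?realn.
  have : `|T n (x + u) - T n (x - u)| <= `|T n (x + u)| + `|T n (x - u)|.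
    exact: ler_normB.
  rewrite -linear_opB// opprB {1}[x + u]addrC addrACA subrr addr0 -mulr2n -scaler_nat.
  rewrite linear_opZ// normrZ normr_nat => h2.
  rewrite -(lerD2l N.+1%:R) -mulr2n -[_ *+ 2]mulr_natl.
  apply: (@le_trans _ _ (2 * `|T n u|)); first by rewrite ler_pM2l.
  by apply: (le_trans h2); rewrite lerD2r.
have [C C0 TC] := bounded_opP (bT n).
have C0' : 0 < C%:C%C :> R[i] by rewrite ltcR.
have D0 : 0 < 1 + r * C%:C%C by rewrite addr_gt0// mulr_gt0.
(* This radius is at most [r / 2], and [C * s <= 1], so the values of [T n] vary
   by at most 1 on the new ball. *)
pose s := r / 2 / (1 + r * C%:C%C).
have s0 : 0 < s by rewrite divr_gt0.
have sr : s <= r / 2.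
  by rewrite ler_pdivrMr// ler_peMr ?(ltW r20)// lerDl mulr_ge0// ltW.
exists y, s; split => //.
  by rewrite xy (le_trans (lerD (lexx _) sr))// -splitr.
exists n => w wy.
have Tw : `|T n (y - w)| <= 1.
  apply: (le_trans (TC _)); rewrite distrC.
  apply: (@le_trans _ _ (C%:C%C * s)); first by rewrite ler_pM2l.
  rewrite /s mulrA ler_pdivrMr// mul1r.
  rewrite (@le_trans _ _ (r * C%:C%C))// ?lerDr// mulrCA mulrA.
  by rewrite ler_piMr ?invf_le1 ?ler1n// mulr_ge0// ltW.
rewrite -(lerD2r 1) natr1 (le_trans Ty)//.
rewrite -[y in leLHS](subrK w) linear_opD// (le_trans (ler_normD _ _))//.
by rewrite addrC lerD2l.
Qed.

(** The principle of uniform boundedness for a sequence of operators on a complex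
    space. If it failed, nested balls with radii tending to 0 could be chosen so
    that on the ball number [N] some member of the sequence exceeds [N]; the
    common point of the balls would contradict pointwise boundedness. *)
Lemma uniform_boundedness T : (forall n, bounded_op (T n)) ->
  (forall x, exists M : R[i], forall n, `|T n x| <= M) ->
  exists M : R[i], forall n x, `|T n x| <= M * `|x|.
Proof.
move=> bT pT; apply: contrapT => nb.
pose P (N : nat) (p q : H * R[i]) := [/\ 0 < q.2, q.2 <= p.2 / 2, `|p.1 - q.1| + q.2 <= p.2 &
    exists n, forall z, `|z - q.1| <= q.2 -> N%:R <= `|T n z|].
have /choice[f fP] : forall Np : nat * (H * R[i]), exists q, 0 < Np.2.2 -> P Np.1 Np.2 q.
  move=> [N [x r]] /=; have [r0|r0] := boolP (0 < r); last by exists (x, r).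
  by have [y [s ?]] := large_value_ball bT nb N x r0; exists (y, s).
pose fix a n := if n is m.+1 then f (m, a m) else (0, 1).
have a0 n : 0 < (a n).2.
  elim: n => [|n IH]; first exact: ltr01.
  by have [] := fP (n, a n) IH.
have aP n : P n (a n) (a n.+1) by exact: (fP (n, a n) (a0 n)).
have ale n : (a n).2 <= 2^-1 ^+ n.
  elim: n => //= n IH; have [_ h _ _] := aP n; apply: (le_trans h).
  by rewrite exprSr ler_wpM2r ?invr_ge0 ?ler0n.
have anest n k : `|(a n).1 - (a (n + k)%N).1| + (a (n + k)%N).2 <= (a n).2.
  elim: k => [|k IH]; first by rewrite addn0 subrr normr0 add0r.
  rewrite addnS; have [_ _ h _] := aP (n + k)%N.
  apply: le_trans IH; apply: le_trans (lerD (lexx _) h).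
  by rewrite addrA lerD2r ler_distD.
have acauchy (e : R[i]) : 0 < e -> exists n, forall m, (n <= m)%N -> `|(a n).1 - (a m).1| < e.
  move=> e0; have [n en] := complex_nat_gt (ltW (etrans (invr_gt0 e) e0)).
  exists n => m nm; apply: (@le_lt_trans _ _ (a n).2).
    by rewrite (le_trans _ (anest n (m - n)%N))// subnKC// lerDl ltW.
  apply: (le_lt_trans (ale n)); rewrite exprVn invf_plt ?posrE ?exprn_gt0//.
  by apply: (lt_trans en); rewrite -natrX ltr_nat ltn_expl.
have : cvg ((fun n => (a n).1) @ \oo).
  suff : cauchy ((fun n => (a n).1) @ \oo) by exact: cauchy_cvg.
  suff : cauchy_ex ((fun n => (a n).1) @ \oo) by exact: cauchy_exP.
  move=> e e0; have [n na] := acauchy e e0.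
  exists (a n).1; exists n => // m /= nm.
  by rewrite -ball_normE /=; exact: na.
move=> /cvg_ex[/= l al].
have ln n : `|l - (a n).1| <= (a n).2.
  rewrite distrC; apply/ler_addgt0Pr => e e0.
  have [N _ h] := @cvgr_dist_lt _ _ _ _ _ _ _ al e e0.
  have := h (n + N)%N (leq_addl _ _) => {}h.
  apply: (le_trans (ler_distD (a (n + N)%N).1 _ _)); apply: lerD.
    by rewrite (le_trans _ (anest n N))// lerDl ltW.
  by rewrite distrC ltW.
have [M TM] := pT l.
have [N MN] := complex_nat_gt (le_trans (normr_ge0 _) (TM 0%N)).
have [_ _ _ [n /(_ l (ln _))]] := aP N.
by move=> /(lt_le_trans MN) /lt_le_trans /(_ (TM n)); rewrite ltxx.
Qed.

(** Banach-Steinhaus: this is what makes the strong derivative of an orbit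
    a bounded operator. *)
Lemma bounded_op_limit T (S : H -> H) : (forall n, bounded_op (T n)) ->
  (forall x, T n x @[n --> \oo] --> S x) -> bounded_op S.
Proof.
move=> bT TS; split.
  move=> c x y.
  apply: (@cvg_unique _ (@norm_hausdorff _ _) _ _ _ _ (TS _)).
  have -> : (fun n => T n (c *: x + y)) = (fun n => c *: T n x + T n y).
    by apply/funext => n; exact: (bounded_op_linear (bT n)).
  by apply: cvgD => //; exact: cvgZl_tmp.
have pT x : exists M : R[i], forall n, `|T n x| <= M.
  have /cvg_seq_bounded/pinfty_ex_gt0[M _ TM] : cvg (T n x @[n --> \oo]).
    by apply/cvg_ex; exists (S x).
  by exists M => n; exact: TM.
have [M TM] := uniform_boundedness bT pT.
exists M => x.
apply/ler_addgt0Pr => e e0.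
have [n _ h] := @cvgr_dist_lt _ _ _ _ _ _ _ (TS x) e e0.
have {}h := h n (leqnn n).
rewrite -[S x](subrK (T n x)) addrC (le_trans (ler_normD _ _))//.
by apply: lerD => //; exact: ltW.
Qed.

End uniform_boundedness.

(** * The hermitian form *)

Section inner_product.
Context {R : realType} {H : completeNormedModType R[i]}.
Context {ip : {dot H for (@Num.conj R[i])}} (hip : hilbert_norm ip).
Implicit Types (S T B : H -> H) (x y z : H).

Lemma ipC x y : ip x y = (ip y x)^*.
Proof. by rewrite hermC expr0 mul1r. Qed.

Lemma ipDl x y z : ip (x + y) z = ip x z + ip y z. Proof. exact: linearDl. Qed.
Lemma ipDr x y z : ip z (x + y) = ip z x + ip z y. Proof. exact: linearDr. Qed.
Lemma ipBl x y z : ip (x - y) z = ip x z - ip y z. Proof. exact: linearBl. Qed.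
Lemma ipBr x y z : ip z (x - y) = ip z x - ip z y. Proof. exact: linearBr. Qed.
Lemma ipZl c x y : ip (c *: x) y = c * ip x y. Proof. exact: linearZl_LR. Qed.
Lemma ipZr c x y : ip x (c *: y) = c^* * ip x y. Proof. exact: linearZr_LR. Qed.

Lemma ip_cauchy_schwarz x y : `|ip x y| <= `|x| * `|y|.
Proof.
have [->|y0] := eqVneq y 0; first by rewrite linear0r !normr0 mulr0.
have ny : 0 < `|y| ^+ 2 by rewrite exprn_gt0// normr_gt0.
pose a := ip x y / `|y| ^+ 2.
have u0 : ip (x - a *: y) (a *: y) = 0.
  by rewrite ipZr ipBl ipZl hip divfK ?gt_eqF// subrr mulr0.
have : `|a *: y| ^+ 2 <= `|x| ^+ 2.
  by rewrite -!hip -[x in leRHS](subrK (a *: y)) hnormDd// lerDr dnorm_ge0.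
rewrite normrZ exprMn /a normrM normfV (ger0_norm (ltW ny)) => h.
rewrite -ler_sqr ?nnegrE ?mulr_ge0// exprMn -ler_pdivrMr//.
apply: le_trans h; rewrite le_eqVlt; apply/orP; left; apply/eqP.
by field; rewrite normr_eq0.
Qed.

Lemma ip_cvg (I : Type) (F : set_system I) {FF : Filter F} (f g : I -> H) x y :
  f i @[i --> F] --> x -> g i @[i --> F] --> y ->
  (ip (f i) (g i) : R[i]^o) @[i --> F] --> (ip x y : R[i]^o).
Proof.
move=> fx gy; apply/cvgrPdist_lt => e e0.
pose m := `|x| + `|y| + 1.
have m0 : 0 < m by rewrite ltr_wpDl// addr_ge0.
have me0 : 0 < m + e by exact: addr_gt0.
pose d := e / (m + e).
have d0 : 0 < d by exact: divr_gt0.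
have d1 : d <= 1 by rewrite ler_pdivrMr// mul1r lerDr ltW.
near=> i.
have fi : `|x - f i| < d by near: i; exact: cvgr_dist_lt.
have gi : `|y - g i| < d by near: i; exact: cvgr_dist_lt.
have -> : ip x y - ip (f i) (g i) = ip (x - f i) y - (ip (x - f i) (y - g i) - ip x (y - g i)).
  by rewrite !ipBl !ipBr; ring.
apply: (@le_lt_trans _ _ (d * m)); last first.
  by rewrite mulrAC ltr_pdivrMr// ltr_pM2l// ltrDl.
apply: (le_trans (ler_normB _ _)).
apply: (@le_trans _ _ (d * `|y| + (d * 1 + `|x| * d))); last first.
  by rewrite /m le_eqVlt; apply/orP; left; apply/eqP; ring.
apply: lerD.
  by apply: (le_trans (ip_cauchy_schwarz _ _)); rewrite ler_wpM2r// ltW.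
apply: (le_trans (ler_normB _ _)); apply: lerD.
  apply: (le_trans (ip_cauchy_schwarz _ _)); apply: ler_pM => //; first exact: ltW.
  by apply: le_trans d1; exact: ltW.
by apply: (le_trans (ip_cauchy_schwarz _ _)); rewrite ler_wpM2l// ltW.
Unshelve. all: by end_near. Qed.

Lemma closed_ip_eq (X : topologicalType) (f g f' g' : X -> H) :
  continuous f -> continuous g -> continuous f' -> continuous g' ->
  closed [set p | ip (f p) (g p) = ip (f' p) (g' p)].
Proof.
move=> cf cg cf' cg'.
have -> : [set p | ip (f p) (g p) = ip (f' p) (g' p)] =
    (fun p => (ip (f p) (g p) - ip (f' p) (g' p) : R[i]^o)) @^-1` [set 0].
  apply/seteqP; split => p /=; first by move=> ->; rewrite subrr.
  by move=> /eqP; rewrite subr_eq0 => /eqP.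
apply: preimage_closed; last first.
  exact: (accessible_closed_set1 (hausdorff_accessible (@norm_hausdorff _ _))).
move=> p _; apply: cvgB; apply: ip_cvg.
- exact: cf.
- exact: cg.
- exact: cf'.
- exact: cg'.
Qed.

Lemma ip_dense_inj (A : set H) x y : dense A -> (forall z, A z -> ip x z = ip y z) -> x = y.
Proof.
move=> dA xy.
have h : forall z, [set z | ip x z = ip y z] z.
  apply: (dense_closed dA); last exact: xy.
  by apply: (@closed_ip_eq _ (cst x) id (cst y) id) => u //; exact: cvg_cst.
apply/eqP; rewrite -subr_eq0 -normr_eq0 -sqrf_eq0 -hip ipBl.
by rewrite (h (x - y)) subrr.
Qed.

Lemma ip_isometry_norm x y : ip x x = ip y y -> `|x| = `|y|.
Proof.
by rewrite !hip => /eqP; rewrite eqrXn2// => /eqP.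
Qed.

(** Polarization. It is valid only because the scalars are complex: the
    vectors [y + z] and [y + i z] together separate [<z, T y>] from [<y, T z>]. *)
Lemma form_eq0 T : linear T -> (forall x, ip (T x) x = 0) -> forall x, T x = 0.
Proof.
move=> lT T0 x.
have pol y z : ip (T y) z + ip (T z) y = 0.
  have := T0 (y + z); rewrite linear_opD// ipDl !ipDr !T0 add0r addr0.
  by [].
apply/eqP; rewrite -normr_eq0 -sqrf_eq0 -hip; apply/eqP.
have h1 := pol x (T x).
have := pol x ('i *: T x).
rewrite linear_opZ// ipZr ipZl conjCi => h2.
have {h2} : 'i * (ip (T (T x)) x - ip (T x) (T x)) = 0.
  by rewrite mulrBr -[RHS]h2 mulNr addrC.
move/eqP; rewrite mulf_eq0 (negbTE (neq0Ci _)) /= subr_eq0 => /eqP h3.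
move: h1; rewrite h3 -mulr2n => /eqP; rewrite mulrn_eq0 /= => /eqP //.
Qed.

Lemma symmetric_dense (E : set H) T : dense E -> bounded_op T ->
  (forall x y, E x -> E y -> ip (T x) y = ip x (T y)) ->
  forall x y, ip (T x) y = ip x (T y).
Proof.
move=> dE bT sT x y; have cT := bounded_op_continuous bT.
apply: (dense_closed (C := [set x | ip (T x) y = ip x (T y)]) dE) => {x}.
  apply: (closed_ip_eq (f := T) (g := cst y) (f' := id) (g' := cst (T y))) => //.
  - by move=> u; exact: cvg_cst.
  - by move=> u; exact: cvg_id.
  - by move=> u; exact: cvg_cst.
move=> x Ex /=.
apply: (dense_closed (C := [set y | ip (T x) y = ip x (T y)]) dE) => {y}.
  apply: (closed_ip_eq (f := cst (T x)) (g := id) (f' := cst x) (g' := T)) => //.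
  - by move=> u; exact: cvg_cst.
  - by move=> u; exact: cvg_id.
  - by move=> u; exact: cvg_cst.
by move=> y Ey; exact: sT.
Qed.

End inner_product.

(** * Commutators with an unbounded operator, and closures *)

Section commutators.
Context {R : realType} {H : completeNormedModType R[i]}.
Context {ip : {dot H for (@Num.conj R[i])}} (hip : hilbert_norm ip).
Implicit Types (A : @partial_op R H) (S T B D U V : H -> H) (x y z : H).

Definition symmetric_op A :=
  forall x y, dom A x -> dom A y -> ip (A x) y = ip x (A y).

(** [B] is the commutator [S A - A S] in the operator sense: besides boundedness
    of [B] this contains the invariance of the domain, without which the compositions
    of [A] with [S] could not be manipulated algebraically. *)
Definition has_comm A S B := [/\ bounded_op S, bounded_op B
  & forall x, dom A x -> dom A (S x) /\ A (S x) = S (A x) - B x].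

Lemma selfadjoint_symmetric A : selfadjoint ip A -> symmetric_op A.
Proof.
by move=> [_ _ sA] x y dx dy; have [/(_ (conj dy erefl) x dx)] := sA y (A y).
Qed.

(** The commutator is defined through a quadratic form. For symmetric [A] the
    operator commutator represents this form, and density together with
    polarization makes it the only bounded operator that does. *)
Lemma comm_has_comm A S B : symmetric_op A -> dense (dom A) -> has_comm A S B ->
  comm ip S A = B.
Proof.
move=> sA dA [bS bB AS].
have PB : forall x, dom A x ->
    inner ip x (B x) = inner ip x (S (A x)) - inner ip (A x) (S x).
  move=> x dx; have [dSx ASx] := AS x dx.
  by rewrite /inner -(sA _ _ dSx dx) ASx ipBl opprB addrC subrK.
rewrite /comm; apply: xget_subset1 => //.
move=> B1 B2 [bB1 B1P] [bB2 B2P]; apply/funext => x.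
apply/eqP; rewrite -subr_eq0; apply/eqP.
have bC : bounded_op (fun x => B1 x - B2 x).
  by apply: bounded_op_add => //; exact: bounded_op_opp.
apply: (form_eq0 (T := fun x => B1 x - B2 x) hip (bounded_op_linear bC)) => {x}.
apply: (dense_closed (C := [set x | ip (B1 x - B2 x) x = 0]) dA).
  have -> : [set x | ip (B1 x - B2 x) x = 0] = [set x | ip (B1 x - B2 x) x = ip 0 0].
    by rewrite linear0r.
  apply: (closed_ip_eq hip (f := fun x => B1 x - B2 x) (g := id) (f' := cst 0) (g' := cst 0)).
  - exact: bounded_op_continuous bC.
  - by move=> x; exact: cvg_id.
  - by move=> x; exact: cvg_cst.
  - by move=> x; exact: cvg_cst.
move=> x dx /=; rewrite ipBl; apply/eqP; rewrite subr_eq0; apply/eqP.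
by rewrite -[ip _ _]/(inner ip x (B1 x)) B1P// -B2P.
Qed.

Lemma has_comm_id A : has_comm A id (fun=> 0).
Proof.
split=> [||x dx]; last by split => //; rewrite subr0.
- by split => //; exists 1 => x; rewrite mul1r.
- split; first by move=> c x y; rewrite scaler0 addr0.
  by exists 1 => x; rewrite normr0 mul1r.
Qed.

(** The Leibniz rule [[S T, A] = S [T, A] + [S, A] T]. *)
Lemma has_comm_comp A S T B C : has_comm A S B -> has_comm A T C ->
  has_comm A (S \o T) (fun x => S (C x) + B (T x)).
Proof.
move=> [bS bB AS] [bT bC AT]; split; first exact: bounded_op_comp.
  by apply: bounded_op_add; apply: (bounded_op_comp (S := _) (T := _)).
move=> x dx /=; have [dTx ATx] := AT x dx; have [dSTx ASTx] := AS _ dTx.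
split => //; rewrite ASTx ATx linear_opB; last exact: bounded_op_linear.
by rewrite opprD addrA.
Qed.

Lemma has_comm_iter A S B n : has_comm A S B -> exists C, has_comm A (iter n S) C.
Proof.
move=> AS; elim: n => [|n [C IH]]; first by exists (fun=> 0); exact: has_comm_id.
by eexists; exact: (has_comm_comp AS IH).
Qed.

(** [S] commutes with [D], so only its commutator with [A] contributes to the
    commutator with [A D + D A]. *)
Lemma has_comm_anticomm A D S B C : has_comm A D C -> has_comm A S B ->
  (forall x, D (S x) = S (D x)) ->
  has_comm (PartialOp (dom A) (fun x => A (D x) + D (A x))) S
    (fun x => B (D x) + D (B x)).
Proof.
move=> [bD _ AD] [bS bB AS] DS; split => //.
  by apply: bounded_op_add; apply: (bounded_op_comp (S := _) (T := _)).
move=> x /= dx; have [dSx ASx] := AS x dx; split => //.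
have [dDx _] := AD x dx; have [_ ASDx] := AS _ dDx.
have [lD lS] := (bounded_op_linear bD, bounded_op_linear bS).
by rewrite DS ASDx ASx (linear_opB lD) (linear_opD lS) DS opprD addrACA.
Qed.

Section closure_symmetric.
Variable T0 : @partial_op R H.
Hypotheses (sT : symmetric_op T0) (dT : dense (dom T0)).

(** The symmetry relation of [T0] is a closed condition on the graph. It therefore
    persists on the closure of the graph, and determines the second component of
    a point of it from the first: a symmetric, densely defined operator is
    closable. *)
Lemma closure_graph_ip x y z : closure (graph T0) (x, y) -> dom T0 z ->
  ip y z = ip x (T0 z).
Proof.
move=> xy dz.
apply: (closure_sub_closed (C := [set p | ip p.2 z = ip p.1 (T0 z)]) _ _ xy).
  apply: (closed_ip_eq hip (f := snd) (g := cst z) (f' := fst) (g' := cst (T0 z))).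
  - by move=> p; exact: cvg_snd.
  - by move=> p; exact: cvg_cst.
  - by move=> p; exact: cvg_fst.
  - by move=> p; exact: cvg_cst.
by move=> [u v] [/= du ->]; exact: sT.
Qed.

Lemma closure_opE x y : closure (graph T0) (x, y) ->
  dom (closure_op T0) x /\ closure_op T0 x = y.
Proof.
move=> xy; split; first by exists y.
apply: xget_subset1 => // u v xu xv.
apply: (ip_dense_inj hip dT) => z dz.
by rewrite (closure_graph_ip xu dz) (closure_graph_ip xv dz).
Qed.

Lemma closure_op_graph x : dom (closure_op T0) x ->
  closure (graph T0) (x, closure_op T0 x).
Proof. by move=> [y xy]; have [_ ->] := closure_opE xy. Qed.

Lemma dom_closure_op : dom T0 `<=` dom (closure_op T0).
Proof. by move=> x dx; exists (T0 x); apply: subset_closure. Qed.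

Lemma symmetric_closure_op : symmetric_op (closure_op T0).
Proof.
move=> x y /closure_op_graph dx /closure_op_graph dy.
move: (closure_op T0 x) (closure_op T0 y) dx dy => x' y' dx dy.
apply: (closure_sub_closed (C := [set p | ip x' p.1 = ip x p.2]) _ _ dy).
  apply: (closed_ip_eq hip (f := cst x') (g := fst) (f' := cst x) (g' := snd)).
  - by move=> p; exact: cvg_cst.
  - by move=> p; exact: cvg_fst.
  - by move=> p; exact: cvg_cst.
  - by move=> p; exact: cvg_snd.
by move=> [u v] [/= du ->]; exact: closure_graph_ip.
Qed.

(** The relation [T0 S = S T0 - B] says that the continuous map sending [(x, y)]
    to [(S x, S y - B x)] preserves the graph of [T0]; it then preserves the
    closure of the graph. *)
Lemma has_comm_closure_op S B : has_comm T0 S B -> has_comm (closure_op T0) S B.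
Proof.
move=> [bS bB TS]; split => // x /closure_op_graph dx.
apply: closure_opE.
pose f (p : H * H) := (S p.1, S p.2 - B p.1).
rewrite -[(S x, _)]/(f (x, closure_op T0 x)).
apply: (closure_sub_closed (C := f @^-1` closure (graph T0)) _ _ dx).
  apply: preimage_closed; last exact: closed_closure.
  move=> p _; apply: cvg_pair => /=.
    by apply: bounded_op_cvg => //; exact: cvg_fst.
  by apply: cvgB; apply: bounded_op_cvg => //; [exact: cvg_snd|exact: cvg_fst].
move=> [u v] [/= du ->]; apply: subset_closure.
by have [dSu TSu] := TS u du.
Qed.

End closure_symmetric.

End commutators.

(** * Unitary operators and regularity along the unitary group *)

Section C1_regularity.
Context {R : realType} {H : completeNormedModType R[i]}.
Context {ip : {dot H for (@Num.conj R[i])}} (hip : hilbert_norm ip).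
Implicit Types (A : @partial_op R H) (S T B D U V : H -> H) (x y z : H).

Lemma unitary_norm U x : unitary ip U -> `|U x| = `|x|.
Proof. by move=> [_ Uip _]; apply: (ip_isometry_norm hip); exact: Uip. Qed.

Lemma unitary_bounded U : unitary ip U -> bounded_op U.
Proof.
move=> hU; split; first by case: hU.
by exists 1 => x; rewrite mul1r unitary_norm.
Qed.

Lemma inv_opK U : unitary ip U -> cancel (inv_op U) U.
Proof. by move=> [_ _ sU] x; have := xgetPex 0 (sU x). Qed.

Lemma unitaryK U : unitary ip U -> cancel U (inv_op U).
Proof.
move=> hU x; apply/eqP; rewrite -subr_eq0 -normr_eq0.
have lU : linear U by case: hU.
by rewrite -(unitary_norm _ hU) linear_opB// inv_opK// subrr normr0.
Qed.

Lemma unitary_inv U : unitary ip U -> unitary ip (inv_op U).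
Proof.
move=> hU; have [lU Uip _] := hU; split.
- move=> c x y; apply: (can_inj (unitaryK hU)).
  by rewrite lU !inv_opK.
- by move=> x y; rewrite -Uip !inv_opK.
- by move=> y; exists (U y); exact: unitaryK.
Qed.

(** Difference quotients are sampled along this sequence, since
    uniform boundedness is stated for sequences. *)
Lemma cvg_inv_dnbhs : (n.+1%:R^-1 : R) @[n --> \oo] --> (0 : R)^'.
Proof.
move=> P; rewrite /dnbhs /within /= => P0.
have h : \forall n \near \oo, @harmonic R n != 0 -> P (harmonic n) := cvg_harmonic P0.
have : \forall n \near \oo, P (@harmonic R n).
  by apply: filterS h => n; apply; rewrite invr_eq0 pnatr_eq0.
exact.
Qed.

Section group.
Variables (A : @partial_op R H) (W : R -> H -> H).
Hypothesis hW : is_exp_group ip A W.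

(** Strong continuity and the isometry property together allow the argument to
    vary with the time. *)
Lemma exp_group_cvg (f : R -> H) y :
  f h @[h --> 0^'] --> y -> W h (f h) @[h --> 0^'] --> y.
Proof.
move=> fy; have [uW [W0 _] cW _] := hW.
have lW h : linear (W h) by case: (uW h).
apply: (@cvg_sub0 _ _ _ _ _ _ (fun h => W h y)).
  apply: norm_cvg0.
  have -> : (fun h => `|((fun h => W h (f h)) - (fun h => W h y)) h|) = (fun h => `|f h - y|).
    by apply/funext => h; rewrite -[(_ - _) h]/(W h (f h) - W h y) -linear_opB// unitary_norm.
  by apply/norm_cvg0P; apply/subr_cvg0.
have := cW y 0; rewrite /continuous_at W0.
by apply: cvg_trans; apply: cvg_app; exact: nbhs_dnbhs.
Qed.

Lemma generatorP x y : (h^-1)%:C%C *: (W h x - x) @[h --> 0^'] --> 'i *: y ->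
  dom A x /\ A x = y.
Proof. by have [_ _ _ gW] := hW; move/gW. Qed.

Lemma generator_cvg x : dom A x ->
  (h^-1)%:C%C *: (W h x - x) @[h --> 0^'] --> 'i *: A x.
Proof. by have [_ _ _ gW] := hW => dx; apply/gW. Qed.

Lemma exp_groupNK h x : W h (W (- h) x) = x.
Proof. by have [_ [W0 WD] _ _] := hW; rewrite -WD subrr W0. Qed.

(** The difference quotients are bounded operators converging pointwise, so
    their limit is bounded. *)
Lemma C1_derivative S : bounded_op S ->
  strongly_C1 (fun t => W (- t) \o S \o W t) ->
  exists2 S', bounded_op S' &
    forall x, (h^-1)%:C%C *: (W (- h) (S (W h x)) - S x) @[h --> 0^'] --> S' x.
Proof.
move=> bS hS; have [uW [W0 _] _ _] := hW.
have /choice[S' S'P] : forall x, exists y,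
    (h^-1)%:C%C *: (W (- h) (S (W h x)) - S x) @[h --> 0^'] --> y.
  move=> x; have [g gP _] := hS x; exists (g 0).
  have := gP 0.
  by under eq_cvg do rewrite /= add0r oppr0 !W0.
exists S' => //.
pose h n : R := n.+1%:R^-1.
apply: (@bounded_op_limit _ _ (fun n x => ((h n)^-1)%:C%C *: (W (- h n) (S (W (h n) x)) - S x))).
  move=> n; apply: bounded_op_scale; apply: bounded_op_add; last exact: bounded_op_opp.
  apply: (bounded_op_comp (S := W (- h n)) (T := S \o W (h n))).
    exact: unitary_bounded.
  by apply: bounded_op_comp => //; exact: unitary_bounded.
move=> x; exact: (cvg_comp _ _ cvg_inv_dnbhs (S'P x)).
Qed.

(** With [F h = W (- h) S (W h)] one has the identity
    [W h S x - S x = S (W h x - x) - W h (F h x - S x)].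
    Divided by [h], its right-hand side converges for [x] in the domain of [A]: this
    puts [S x] in the domain of the generator and computes [A (S x)]. *)
Lemma C1_has_comm S : bounded_op S ->
  strongly_C1 (fun t => W (- t) \o S \o W t) -> exists B, has_comm A S B.
Proof.
move=> bS hS; have [S' bS' S'P] := C1_derivative bS hS.
exists (fun x => - 'i *: S' x); split => //; first exact: bounded_op_scale.
move=> x dx; apply: generatorP.
have [uW _ _ _] := hW.
have lW h : linear (W h) by case: (uW h).
have lS := bounded_op_linear bS.
have -> : (fun h => (h^-1)%:C%C *: (W h (S x) - S x)) =
    (fun h => S ((h^-1)%:C%C *: (W h x - x))
              - W h ((h^-1)%:C%C *: (W (- h) (S (W h x)) - S x))).
  apply/funext => h; rewrite (linear_opZ lS) (linear_opZ (lW h)) -scalerBr.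
  congr (_ *: _); rewrite (linear_opB lS) (linear_opB (lW h)) exp_groupNK.
  by rewrite opprB [RHS]addrC addrA subrK.
have -> : 'i *: (S (A x) - - 'i *: S' x) = S ('i *: A x) - S' x.
  rewrite scalerBr (linear_opZ lS) scalerA mulrN -expr2 sqrCi opprK scale1r//.
apply: cvgB; first by apply: bounded_op_cvg => //; exact: generator_cvg.
exact/exp_group_cvg/S'P.
Qed.

(** For [V] the inverse of [U] and [F h = W (- h) U (W h)] one has
    [W h V x - V x = V (W h (F h (V x) - U (V x)) + (W h x - x))],
    so the derivative of [F] also controls the inverse. *)
Lemma C1_has_comm_inv U : unitary ip U ->
  strongly_C1 (fun t => W (- t) \o U \o W t) -> exists B, has_comm A (inv_op U) B.
Proof.
move=> hU hS; have bU := unitary_bounded hU.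
have bV := unitary_bounded (unitary_inv hU).
have [S' bS' S'P] := C1_derivative bU hS.
pose V := inv_op U.
exists (fun x => 'i *: V (S' (V x))); split => //.
  apply: bounded_op_scale; apply: (bounded_op_comp (S := V) (T := S' \o V)) => //.
  exact: bounded_op_comp.
move=> x dx; apply: generatorP; rewrite -/V.
have [uW _ _ _] := hW.
have lW h : linear (W h) by case: (uW h).
have lV : linear V := bounded_op_linear bV.
have [UV VU] : cancel V U /\ cancel U V := conj (inv_opK hU) (unitaryK hU).
have -> : (fun h => (h^-1)%:C%C *: (W h (V x) - V x)) =
    (fun h => V (W h ((h^-1)%:C%C *: (W (- h) (U (W h (V x))) - U (V x)))
              + (h^-1)%:C%C *: (W h x - x))).
  apply/funext => h; rewrite (linear_opZ (lW h)) -scalerDr (linear_opZ lV).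
  congr (_ *: _); rewrite (linear_opB (lW h)) exp_groupNK UV addrA subrK.
  by rewrite (linear_opB lV) VU.
have -> : 'i *: (V (A x) - 'i *: V (S' (V x))) = V (S' (V x) + 'i *: A x).
  by rewrite scalerBr scalerA -expr2 sqrCi scaleN1r opprK addrC (linear_opD lV) (linear_opZ lV).
apply: bounded_op_cvg => //; apply: cvgD; last exact: generator_cvg.
exact/exp_group_cvg/S'P.
Qed.

End group.

End C1_regularity.

(** * The conjugated commutators and the averaged operator *)

Section averaging.
Context {R : realType} {H : completeNormedModType R[i]}.
Context {ip : {dot H for (@Num.conj R[i])}} (hip : hilbert_norm ip).
Implicit Types (S T D : H -> H) (x y z : H).

Variables (U : H -> H) (A : @partial_op R H).
Hypotheses (hU : unitary ip U) (sA : symmetric_op (ip := ip) A) (dA : dense (dom A)).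
Variables B B' : H -> H.
Hypotheses (AU : has_comm A U B) (AV : has_comm A (inv_op U) B').
Notation V := (inv_op U).

Lemma iter_invK n x : iter n U (iter n V x) = x.
Proof. by elim: n x => //= n IH x; rewrite -iterS iterSr /= (inv_opK hU). Qed.

Lemma ip_iter n x y : ip (iter n U x) y = ip x (iter n V y).
Proof.
elim: n x => //= n IH x; rewrite -iterS iterSr IH.
by have [_ Uip _] := hU; rewrite -[RHS]Uip (inv_opK hU).
Qed.

Lemma norm_iter n x : `|iter n U x| = `|x|.
Proof. by elim: n => //= n <-; exact: (unitary_norm hip _ hU). Qed.

Lemma norm_iter_inv n x : `|iter n V x| = `|x|.
Proof. by rewrite -[in RHS](iter_invK n x) norm_iter. Qed.

(** This is [[A, U^N] U^(-N)]. On the domain of [A] it equals [A - U^N A U^(-N)],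
    which is where all its properties come from. *)
Definition conj_comm N x := rcomm ip A (iter N U) (iter N V x).

Lemma conj_comm_ex N : exists2 C, has_comm A (iter N U) C &
  forall x, conj_comm N x = - C (iter N V x).
Proof.
have [C AC] := has_comm_iter N AU; exists C => // x.
by rewrite /conj_comm /rcomm (comm_has_comm hip sA dA AC).
Qed.

Lemma dom_iter_inv n x : dom A x -> dom A (iter n V x).
Proof. by move=> dx; have [C [_ _ AC]] := has_comm_iter n AV; have [] := AC x dx. Qed.

Lemma conj_comm_bounded N : bounded_op (conj_comm N).
Proof.
have [C [_ bC _] CN] := conj_comm_ex N.
have -> : conj_comm N = fun x => - (C \o iter N V) x by apply/funext => x; rewrite CN.
apply/bounded_op_opp/bounded_op_comp => //; apply: bounded_op_iter.
exact/(unitary_bounded hip)/(unitary_inv hip).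
Qed.

Lemma conj_commE N x : dom A x ->
  conj_comm N x = A x - iter N U (A (iter N V x)).
Proof.
move=> dx; have [C [_ _ AC] ->] := conj_comm_ex N.
have [_] := AC _ (dom_iter_inv N dx).
by rewrite iter_invK => ->; rewrite addrAC subrr add0r.
Qed.

Lemma conj_comm_sym N x y : ip (conj_comm N x) y = ip x (conj_comm N y).
Proof.
move: x y; apply: (symmetric_dense hip dA (conj_comm_bounded N)) => x y dx dy.
rewrite !conj_commE// ipBl ipBr ip_iter sA//.
rewrite (sA (dom_iter_inv N dx) (dom_iter_inv N dy)).
by rewrite [ip x (iter _ _ _)]ipC ip_iter -ipC.
Qed.

(** Conjugating the operator number [N] by [U] changes it by the difference of
    [[A, U] U^(-1)] conjugated by [U^N] and itself: a bound uniform in [N]. After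
    division by [N] the change disappears in the limit, whence [U D = D U]. *)
Lemma conj_comm_conj_bounded : exists C : R[i], forall N x, dom A x ->
  `|U (conj_comm N (V x)) - conj_comm N x| <= C * `|x|.
Proof.
have [C C0 hC] := bounded_opP (conj_comm_bounded 1).
have lU : linear U by case: hU.
have bUN N := bounded_op_iter N (unitary_bounded hip hU).
exists (C%:C%C *+ 2) => N x dx.
have -> : U (conj_comm N (V x)) - conj_comm N x =
    iter N U (conj_comm 1 (iter N V x)) - conj_comm 1 x.
  rewrite !conj_commE//; [|exact: dom_iter_inv|exact: (dom_iter_inv 1)].
  rewrite (linear_opB lU) (linear_opB (bounded_op_linear (bUN N))) /=.
  rewrite -[V (iter N V x)]/(iter N.+1 V x) iterSr -!iterS (iterSr N U).
  by rewrite !opprB addrACA [in RHS]addrACA; congr (_ + _); rewrite addrC.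
apply: (le_trans (ler_normB _ _)); rewrite norm_iter.
rewrite mulr2n mulrDl; apply: lerD => //.
by apply: (le_trans (hC _)); rewrite norm_iter_inv.
Qed.

Section limit_operator.
Variable D : H -> H.
Hypotheses (bD : bounded_op D)
  (hlim : op_norm_cvg (fun N x => N%:R^-1 *: conj_comm N x) D).

Lemma conj_comm_cvg x : n%:R^-1 *: conj_comm n x @[n --> \oo] --> D x.
Proof.
apply/cvgrPdist_le => e e0; have /complex_realP[r er] := gtr0_real e0.
have r0 : 0 < r by rewrite -(ltcR 0) -er.
have x0 : 0 < `|x| + 1 by rewrite ltr_wpDl.
have /complex_realP[m xm] := gtr0_real x0.
have m0 : 0 < m by rewrite -(ltcR 0) -xm.
have := hlim (divr_gt0 r0 m0); apply: filterS => n /(_ x) h.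
rewrite distrC (le_trans h)// rmorphM/= fmorphV/= -er -xm.
by rewrite mulrAC ler_pdivrMr// ler_pM2l// lerDl.
Qed.

Lemma limit_sym x y : ip (D x) y = ip x (D y).
Proof.
pose f n : R[i]^o := ip (n%:R^-1 *: conj_comm n x) y.
have fx : f n @[n --> \oo] --> (ip (D x) y : R[i]^o).
  by apply: ip_cvg => //; [exact: conj_comm_cvg|exact: cvg_cst].
have fE : f = fun n => ip x (n%:R^-1 *: conj_comm n y).
  by apply/funext => n; rewrite /f ipZl ipZr conj_comm_sym fmorphV /= conjC_nat.
have fy : f n @[n --> \oo] --> (ip x (D y) : R[i]^o).
  by rewrite fE; apply: ip_cvg => //; [exact: cvg_cst|exact: conj_comm_cvg].
exact: (@cvg_unique _ (@norm_hausdorff _ R[i]^o) _ _ _ _ fx fy).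
Qed.

(** By conjugation: [U D U^(-1) - D] is the limit of a bounded sequence divided
    by [N]. *)
Lemma limit_comm x : D (U x) = U (D x).
Proof.
have bU := unitary_bounded hip hU; have bV := unitary_bounded hip (unitary_inv hip hU).
have lU := bounded_op_linear bU.
have h y : U (D (V y)) = D y.
  move: y; apply: (bounded_op_eq dA (S := U \o D \o V)) => //.
    by apply: bounded_op_comp => //; exact: bounded_op_comp.
  move=> y dy /=; apply/eqP; rewrite -subr_eq0; apply/eqP.
  have [C hC] := conj_comm_conj_bounded.
  apply: (@cvg_inv_nat_bounded _ _ (fun N => U (conj_comm N (V y)) - conj_comm N y) (C * `|y|)).
    by move=> n; exact: hC.
  under eq_cvg do rewrite scalerBr -(linear_opZ lU).
  by apply: cvgB; [apply: bounded_op_cvg => //|]; exact: conj_comm_cvg.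
by rewrite -h (unitaryK hip hU).
Qed.

Lemma limit_comm_inv x : D (V x) = V (D x).
Proof. by apply: (can_inj (unitaryK hip hU)); rewrite -limit_comm !(inv_opK hU). Qed.

Lemma limit_comm_iter n x : D (iter n U x) = iter n U (D x).
Proof. by elim: n => //= n <-; exact: limit_comm. Qed.

Lemma limit_comm_iter_inv n x : D (iter n V x) = iter n V (D x).
Proof. by elim: n => //= n <-; exact: limit_comm_inv. Qed.

Variables (C : H -> H).
Hypothesis AD : has_comm A D C.
Notation T0 := (PartialOp (dom A) (fun x => A (D x) + D (A x))).
Notation G := (anticomm_op A D).

Lemma symmetric_anticomm : symmetric_op (ip := ip) T0.
Proof.
move=> x y /= dx dy; have [_ _ hD] := AD.
have [dDx _] := hD x dx; have [dDy _] := hD y dy.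
by rewrite ipDl ipDr sA// !limit_sym sA// addrC.
Qed.

Lemma has_comm_anticomm_op S E : has_comm A S E -> (forall x, D (S x) = S (D x)) ->
  has_comm G S (fun x => E (D x) + D (E x)).
Proof.
move=> AS DS; apply: (has_comm_closure_op hip symmetric_anticomm dA).
exact: has_comm_anticomm AD AS DS.
Qed.

Lemma symmetric_anticomm_op : symmetric_op (ip := ip) G.
Proof. exact: (symmetric_closure_op hip symmetric_anticomm dA). Qed.

Lemma dom_anticomm_iter_inv n x : dom G x -> dom G (iter n V x).
Proof.
move=> dx; have [E AE] := has_comm_iter n AV.
by have [_ _ /(_ x dx)[]] := has_comm_anticomm_op AE (limit_comm_iter_inv n).
Qed.

Lemma symmetric_averaged N : symmetric_op (ip := ip) (averaged_op U G N).
Proof.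
move=> x y /= dx dy; rewrite ipZl ipZr fmorphV /= conjC_nat; congr (_ * _).
rewrite linear_sumlz linear_sumr /=; apply: eq_bigr => n _.
rewrite ip_iter symmetric_anticomm_op; [|exact: dom_anticomm_iter_inv..].
by rewrite [RHS]ipC ip_iter -ipC.
Qed.

Lemma dense_anticomm : dense (dom G).
Proof.
move=> O O0 oO; have [x [Ox dx]] := dA O0 oO.
by exists x; split => //; exact: (dom_closure_op (T0 := T0)).
Qed.

(** The averages telescope: [G_N - U G_N U^(-1)] is [1/N] times
    [G - U^N G U^(-N)], where [G] is the closure of [A D + D A] and [G_N] its
    average, and the latter difference is [K_N D + D K_N] with
    [K_N = [A, U^N] U^(-N)]. *)
Lemma has_comm_averaged N : has_comm (averaged_op U G N) U
  (fun x => - (N%:R^-1 *: (conj_comm N (D (U x)) + D (conj_comm N (U x))))).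
Proof.
have bU := unitary_bounded hip hU; have lU := bounded_op_linear bU.
have bK := conj_comm_bounded N.
split => //.
  apply/bounded_op_opp/bounded_op_scale/bounded_op_add.
    by apply: (bounded_op_comp (S := conj_comm N \o D)) => //; exact: bounded_op_comp.
  by apply: (bounded_op_comp (S := D \o conj_comm N)) => //; exact: bounded_op_comp.
move=> x /= dx; have [_ _ /(_ x dx)[dUx _]] := has_comm_anticomm_op AU limit_comm.
split => //; rewrite opprK (linear_opZ lU) -scalerDr; congr (_ *: _).
(* Writing [x] as [V (U x)] turns both sums into sums of consecutive terms of
   the same sequence. *)
pose a n := iter n U (G (iter n V (U x))).
have -> : U (\sum_(0 <= n < N) iter n U (G (iter n V x))) = \sum_(0 <= n < N) a n.+1.
  rewrite -[LHS]/(linear_pack lU _) linear_sum /=; apply: eq_bigr => n _.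
  by rewrite /a [iter n.+1 V _]iterSr (unitaryK hip hU).
apply/eqP; rewrite addrC -subr_eq -sumrB.
under eq_bigr do rewrite -opprB.
rewrite sumrN telescope_sumr// opprB; apply/eqP.
have [E AE KE] := conj_comm_ex N.
have [_ _ hE] := has_comm_anticomm_op AE (limit_comm_iter N).
have [_] := hE _ (dom_anticomm_iter_inv N dUx).
rewrite iter_invK /a /= => ->; rewrite addrAC subrr add0r !KE.
rewrite limit_comm_iter_inv opprD (linear_opN (bounded_op_linear bD)) //.
Qed.

Lemma rcomm_averaged N x : rcomm ip (averaged_op U G N) U x =
  N%:R^-1 *: (conj_comm N (D (U x)) + D (conj_comm N (U x))).
Proof.
rewrite /rcomm (comm_has_comm hip (@symmetric_averaged N) _ (has_comm_averaged N)).
  by rewrite opprK.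
exact: dense_anticomm.
Qed.

End limit_operator.

End averaging.

(** * The lower bound *)

Section lower_bound.
Context {R : realType} {H : completeNormedModType R[i]}.
Context {ip : {dot H for (@Num.conj R[i])}} (hip : hilbert_norm ip).

(** The order of the complex numbers compares only numbers with equal imaginary
    parts, so that [z + z^*] being real is part of the assertion. *)
Lemma two_Re_add_ge0 (z r : R[i]) : 0 <= r -> 2 * `|z| <= r -> 0 <= z + z^* + r.
Proof.
move=> r0 zr.
have zre : z + z^* \is Num.real by rewrite CrealE rmorphD/= conjCK addrC.
rewrite -lerBlDr sub0r.
have : `|z + z^*| <= r.
  apply: le_trans zr; apply: (le_trans (ler_normD _ _)).
  by rewrite norm_conjC mulr_natl mulr2n.
by rewrite real_ler_norml// => /andP[].
Qed.

(** With [w = S z - D z], the quadratic form of [S D + D S - 2 D^2] at [z] is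
    [<w, D z> + <D z, w>], hence real and at least [- 2 |w| |D z|]. Symmetry of [S] and
    [D] is what makes the form real. *)
Lemma anticommutator_lower_bound (S D : H -> H) (d M : R[i]) z :
  (forall x y, ip (S x) y = ip x (S y)) -> (forall x y, ip (D x) y = ip x (D y)) ->
  0 <= d -> 0 <= M -> `|S z - D z| <= d * `|z| -> `|D z| <= M * `|z| ->
  0 <= ip (S (D z) + D (S z) - (2 *: D (D z) - (2 * d * M) *: z)) z.
Proof.
move=> sS sD d0 M0 SDz Dz.
have -> : ip (S (D z) + D (S z) - (2 *: D (D z) - (2 * d * M) *: z)) z =
    ip (S z - D z) (D z) + (ip (S z - D z) (D z))^* + 2 * d * M * `|z| ^+ 2.
  rewrite -ipC !ipBl !ipBr !ipZl ipDl hip (sS (D z)) (sD (S z)) (sD (D z)).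
  by ring.
apply: two_Re_add_ge0; first by rewrite !mulr_ge0 ?exprn_ge0.
rewrite -!mulrA ler_pM2l// (le_trans (ip_cauchy_schwarz hip _ _))//.
have -> : d * (M * `|z| ^+ 2) = (d * `|z|) * (M * `|z|) by ring.
exact: ler_pM.
Qed.

Lemma measurable_relative_open (O : set R[i]^o) : open O ->
  measurable (O `&` unit_circle : set (borelC (R := R))).
Proof.
move=> oO; apply: measurableI; first exact: sub_sigma_algebra.
rewrite -[unit_circle]setCK; apply: measurableC; apply: sub_sigma_algebra.
rewrite /= openC.
have -> : unit_circle = (fun z : R[i]^o => `|z| : R[i]^o) @^-1` [set 1] by [].
apply: preimage_closed; last first.
  exact: (accessible_closed_set1 (hausdorff_accessible (@norm_hausdorff _ _))).
by move=> z _; exact: norm_continuous.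
Qed.

End lower_bound.

Theorem proposition2p7 (R : realType) (H : completeNormedModType R[i])
  (ip : {dot H for (@Num.conj R[i])}) (hip : hilbert_norm ip)
  (U : H -> H) (hU : unitary ip U)
  (A : @partial_op R H) (hA : selfadjoint ip A) (hUA : C1 ip U A)
  (D : H -> H) (hD : bounded_op D)
  (hlim : op_norm_cvg (fun N x =>
     N%:R^-1 *: rcomm ip A (iter N U) (iter N (inv_op U) x)) D)
  (hDA : C1 ip D A) :
  (forall e : R, 0 < e -> exists2 Ne : nat, (0 < Ne)%N &
     forall N : nat, (Ne <= N)%N ->
       op_le ip (fun x => 2 *: D (D x) - e%:C%C *: x)
         (inv_op U \o rcomm ip (averaged_op U (anticomm_op A D) N) U))
  /\
  (forall E, spectral_measure ip U E ->
   forall (Theta : set R[i]^o) (c : R),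
     (exists2 O : set R[i]^o, open O & Theta = O `&` unit_circle) ->
     0 < c ->
     op_le ip (fun x => c%:C%C *: E Theta x) (fun x => D (D (E Theta x))) ->
     exists (N : nat) (a : R), [/\ (0 < N)%N, 0 < a &
       op_le ip (fun x => a%:C%C *: E Theta x)
         (E Theta \o inv_op U
            \o rcomm ip (averaged_op U (anticomm_op A D) N) U \o E Theta)]).
Proof.
have sA := selfadjoint_symmetric hA.
have dA : dense (dom A) by case: hA.
have [bU [W hW hUW]] := hUA.
have [B AU] := C1_has_comm hip hW bU hUW.
have [B' AV] := C1_has_comm_inv hip hW hU hUW.
have [_ [W' hW' hDW]] := hDA.
have [C AD] := C1_has_comm hip hW' hD hDW.
have UD := limit_comm hip hU sA dA AU AV hD hlim.
have sD := limit_sym hip hU sA dA AU AV hlim.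
have Uip y z : ip (U y) (U z) = ip y z by have [_ + _] := hU; exact.
have [UV lU] := (inv_opK hU, bounded_op_linear bU).
have part1 (e : R) : 0 < e -> exists2 Ne : nat, (0 < Ne)%N &
     forall N : nat, (Ne <= N)%N ->
       op_le ip (fun x => 2 *: D (D x) - e%:C%C *: x)
         (inv_op U \o rcomm ip (averaged_op U (anticomm_op A D) N) U).
  move=> e0; have [M M0 DM] := bounded_opP hD.
  (* The precision [d] for which [2 d M = e]. *)
  have d0 : 0 < e / (2 * M) by rewrite divr_gt0// mulr_gt0.
  have [N0 _ hN] := hlim _ d0.
  exists N0.+1 => // N /ltnW /hN {}hN x.
  rewrite /inner /comp (rcomm_averaged hip hU sA dA AU AV hD hlim AD).
  pose DN y := N%:R^-1 *: conj_comm (ip := ip) U A N y.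
  have sDN y z : ip (DN y) z = ip y (DN z).
    by rewrite ipZl ipZr (conj_comm_sym hip hU sA dA AU AV) fmorphV /= conjC_nat.
  have DNDz : `|DN (U x) - D (U x)| <= (e / (2 * M))%:C%C * `|U x| by exact: hN.
  have := anticommutator_lower_bound hip sDN sD _ _ DNDz (DM (U x)).
  rewrite !ler0c => /(_ (ltW d0) (ltW M0)).
  have -> : 2 * (e / (2 * M))%:C%C * M%:C%C = e%:C%C.
    rewrite -(rmorph_nat (real_complex R)) -!rmorphM /=; congr (_%:C%C).
    by field; rewrite gt_eqF.
  rewrite -[ip (_ - (_ - _)) x]Uip (linear_opB lU) UV !(linear_opB lU) !(linear_opZ lU) -!UD.
  by rewrite /DN scalerDr (linear_opZ (bounded_op_linear hD)).
split => // E [hE _ _ _ _] Theta c [X oX ThetaE] c0 DE.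
have [|bE EE sE] := hE Theta; first by rewrite ThetaE; exact: measurable_relative_open.
have {}sE u v : ip (E Theta u) v = ip u (E Theta v) by rewrite -[LHS](sE v u).
have [N N0 hN] := part1 c c0.
exists N, c; split => // x.
have := hN N (leqnn N) (E Theta x); have := DE (E Theta x).
rewrite /inner /comp EE; set y := E Theta x; set r := inv_op U _ => h1 h2.
(* At [y = E Theta x] the first part bounds the form of the commutator below by
   [2 <y, D^2 y> - c |y|^2], and the hypothesis gives [<y, D^2 y> >= c |y|^2]. *)
have -> : ip (E Theta r - c%:C%C *: y) x =
    ip (r - (2 *: D (D y) - c%:C%C *: y)) y + 2 * ip (D (D y) - c%:C%C *: y) y.
  rewrite !ipBl !ipZl sE -/y.
  have -> : ip y x = ip y y by rewrite /y -sE EE.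
  by ring.
by rewrite addr_ge0// mulr_ge0.
Qed.
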